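(* Suppose $G$ is a t.d.l.c.s.c. group, $U$ is a compact open subgroup of $G$, and $D$ is a set of selector functions for $F(G)$. Then $G$ is elementary if and only if the decomposition tree $T_{(U,D)}(G)$ is well-founded.
   Context: A t.d.l.c.s.c. group is a totally disconnected locally compact second countable (Hausdorff) topological group. The class $\mathscr{E}$ of elementary groups is the smallest class of t.d.l.c.s.c. groups such that: (i) $\mathscr{E}$ contains all second countable profinite groups and all countable discrete groups; (ii) if $G$ is a t.d.l.c.s.c. group and $H\trianglelefteq G$ is a closed normal subgroup with $H\in\mathscr{E}$ and $G/H$ either profinite or discrete, then $G\in\mathscr{E}$; (iii) if $G$ is a t.d.l.c.s.c. group and $G=\bigcup_{i\in\mathbb{N}}O_i$ where $(O_i)_{i\in\mathbb{N}}$ is an $\subseteq$-increasing sequence of open subgroups of $G$ with $O_i\in\mathscr{E}$ for each $i$, then $G\in\mathscr{E}$. $F(G)$ is the set of closed subsets of $G$, with the Effros Borel structure. A set of selector functions for $F(G)$ is a sequence $D=\{d_n\}_{n\in\mathbb{N}}$ of Borel functions $d_n:F(G)\to G$ such that for every nonempty $F\in F(G)$, $\{d_n(F)\}_{n\in\mathbb{N}}$ is a dense subset of $F$. For a t.d.l.c.s.c. group $H$, the discrete residual $\mathrm{Res}(H)$ is the intersection of all open normal subgroups of $H$. For a closed subgroup $H\leqslant G$ and $n\in\mathbb{N}$, put $R_n^{(U,D)}(H):=\langle U\cap H,d_0(H),\dots,d_n(H)\rangle$ (an open, hence closed, subgroup of $H$). $\mathbb{N}^{<\mathbb{N}}$ is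 the set of finite sequences of natural numbers (including the empty sequence $\emptyset$); $s*n$ is $s$ extended by the entry $n$. A tree is a subset $T\subseteq\mathbb{N}^{<\mathbb{N}}$ closed under initial segments; it is well-founded if there is no $\alpha\in\mathbb{N}^{\mathbb{N}}$ with $(\alpha(0),\dots,\alpha(n-1))\in T$ for all $n$. The decomposition tree $T_{(U,D)}(G)$ and the associated closed subgroups $G_s$ are defined inductively: $\emptyset\in T_{(U,D)}(G)$ and $G_\emptyset:=G$; given $s\in T_{(U,D)}(G)$ and $G_s$, for every $n\in\mathbb{N}$ one puts $s*n\in T_{(U,D)}(G)$ with $G_{s*n}:=\mathrm{Res}\big(R_n^{(U,D)}(G_s)\big)$ if and only if $G_s\neq\{1\}$. *)

(* Defs.v *)
From HB Require Import structures.
From mathcomp Require Import all_boot all_classical.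
From mathcomp Require Import reals topology measurable_structure.

Set Implicit Arguments.
Unset Strict Implicit.
Unset Printing Implicit Defensive.

Local Open Scope classical_set_scope.
Local Open Scope group_scope.

HB.mixin Record isTopologicalGroup G & Topological G & Group G := {
  mulg_continuous : continuous (fun x : G * G => x.1 * x.2 : G) ;
  invg_continuous : continuous (fun x : G => x^-1)
}.

#[short(type="topologicalGroupType")]
HB.structure Definition TopologicalGroup :=
  {G of Topological G & Group G & isTopologicalGroup G}.

Section abstract_subgroups.
Context {G : groupType}.
Implicit Types A : set G.

Definition is_subgroup A :=
  [/\ A 1, (forall x y, A x -> A y -> A (x * y)) & (forall x, A x -> A x^-1)].

Definition is_normal A := forall x g, A x -> A (x ^ g).

Lemma is_subgroup_smallest A : is_subgroup (smallest is_subgroup A).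
Proof.
split=> [B [[B1 _ _] _] //|x y Ax Ay B BP|x Ax B BP].
  by case: (BP) => -[_ BM _] _; apply: BM; [exact: Ax|exact: Ay].
by case: (BP) => -[_ _ BV] _; apply: BV; exact: Ax.
Qed.

End abstract_subgroups.

Record subgroup (G : groupType) := Subgroup {
  subgroup_set :> set G ;
  subgroupP : is_subgroup subgroup_set
}.

Record normal_subgroup (G : groupType) := NormalSubgroup {
  normal_subgroup_subgroup :> subgroup G ;
  normal_subgroupP : is_normal (normal_subgroup_subgroup : set G)
}.

Definition generated (G : groupType) (A : set G) : subgroup G :=
  Subgroup (is_subgroup_smallest A).

(* The type of elements of H; its topology is the library's subspace topology
   on the coercion of a set to a type. *)
Definition subgroup_type (G : groupType) (H : subgroup G) : Type :=
  set_type (subgroup_set H).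

Section subgroup_group.
Context {G : groupType} (H : subgroup G).

HB.instance Definition _ := SubChoice.on (subgroup_type H).

Lemma subgroup_group_closed :
  group_closed (fun x : G => x \in subgroup_set H).
Proof.
case: (subgroupP H) => H1 HM HV; split; first exact/mem_set.
move=> x y /set_mem Hx /set_mem Hy; apply/mem_set.
by apply: HM => //; exact: HV.
Qed.

HB.instance Definition _ :=
  SubChoice_isSubGroup.Build G _ (subgroup_type H) subgroup_group_closed.

End subgroup_group.

Section topological_subgroup.
Context {G : topologicalGroupType} (H : subgroup G).

HB.instance Definition _ :=
  Topological.copy (subgroup_type H) (set_type (subgroup_set H)).

Lemma subgroup_val_continuous : continuous (val : subgroup_type H -> G).
Proof. exact: (@initial_continuous _ G (@set_val G H)). Qed.

Lemma continuous_to_subgroup (X : topologicalType) (f : X -> subgroup_type H) :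
  continuous (val \o f) -> continuous f.
Proof. exact: (@continuous_comp_initial _ X G (@set_val G H)). Qed.

Lemma subgroup_mulg_continuous :
  continuous (fun x : subgroup_type H * subgroup_type H => x.1 * x.2
              : subgroup_type H).
Proof.
apply: continuous_to_subgroup => x.
have -> : val \o (fun x : subgroup_type H * subgroup_type H => x.1 * x.2) =
  (fun y : G * G => y.1 * y.2) \o
  (fun x : subgroup_type H * subgroup_type H => (val x.1, val x.2)).
  by [].
apply: continuous_comp; last exact: mulg_continuous.
apply: cvg_pair.
  by apply: continuous_comp; [exact: cvg_fst|exact: subgroup_val_continuous].
by apply: continuous_comp; [exact: cvg_snd|exact: subgroup_val_continuous].
Qed.

Lemma subgroup_invg_continuous :
  continuous (fun x : subgroup_type H => x^-1).
Proof.
apply: continuous_to_subgroup => x.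
have -> : val \o (fun x : subgroup_type H => x^-1) =
  (fun y : G => y^-1) \o (val : subgroup_type H -> G).
  by [].
apply: continuous_comp; first exact: subgroup_val_continuous.
exact: invg_continuous.
Qed.

HB.instance Definition _ := isTopologicalGroup.Build (subgroup_type H)
  subgroup_mulg_continuous subgroup_invg_continuous.

End topological_subgroup.

Section quotient_group.
Context {G : groupType} (N : normal_subgroup G).
Local Open Scope quotient_scope.

Definition coset_rel (x y : G) : bool := `[< (N : set G) (x^-1 * y) >].

Lemma coset_rel_refl : reflexive coset_rel.
Proof.
by move=> x; apply/asboolP; rewrite mulVg; case: (subgroupP N).
Qed.

Lemma coset_rel_sym : symmetric coset_rel.
Proof.
have sym x y : coset_rel x y -> coset_rel y x.
  move=> /asboolP Nxy; apply/asboolP.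
  have [_ _ NV] := subgroupP N.
  by have := NV _ Nxy; rewrite invgM invgK.
by move=> x y; apply/idP/idP; exact: sym.
Qed.

Lemma coset_rel_trans : transitive coset_rel.
Proof.
move=> y x z /asboolP Nxy /asboolP Nyz; apply/asboolP.
have [_ NM _] := subgroupP N.
by have := NM _ _ Nxy Nyz; rewrite -mulgA mulVKg.
Qed.

Canonical coset_equiv :=
  EquivRel coset_rel coset_rel_refl coset_rel_sym coset_rel_trans.

Definition quotient_group : Type := {eq_quot coset_equiv}.

HB.instance Definition _ := Quotient.copy quotient_group {eq_quot coset_equiv}.
HB.instance Definition _ := [Sub quotient_group of G by %/].
HB.instance Definition _ := [Choice of quotient_group by <:].

Definition coset (x : G) : quotient_group := \pi_quotient_group x.

Lemma cosetP x y : (coset x = coset y) <-> (N : set G) (x^-1 * y).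
Proof.
split=> [/eqmodP/asboolP//|Nxy]; apply/eqmodP; exact/asboolP.
Qed.

Lemma reprK_coset q : coset (repr q) = q.
Proof. exact: reprK. Qed.

Definition quotient_one : quotient_group := coset 1.
Definition quotient_mul (p q : quotient_group) : quotient_group :=
  coset (repr p * repr q).
Definition quotient_inv (q : quotient_group) : quotient_group :=
  coset (repr q)^-1.

Lemma coset_mul x y : quotient_mul (coset x) (coset y) = coset (x * y).
Proof.
apply/cosetP; set x' := repr _; set y' := repr _.
have [_ NM _] := subgroupP N.
have Nx : (N : set G) (x'^-1 * x) by apply/cosetP; rewrite reprK_coset.
have Ny : (N : set G) (y'^-1 * y) by apply/cosetP; rewrite reprK_coset.
have -> : (x' * y')^-1 * (x * y) = (x'^-1 * x) ^ y' * (y'^-1 * y).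
  by rewrite invgM conjgE -!mulgA mulVKg.
by apply: NM => //; exact: normal_subgroupP.
Qed.

Lemma coset_inv x : quotient_inv (coset x) = coset x^-1.
Proof.
apply/cosetP; set x' := repr _.
have [_ _ NV] := subgroupP N.
have Nx : (N : set G) (x'^-1 * x) by apply/cosetP; rewrite reprK_coset.
have -> : x'^-1^-1 * x^-1 = (x'^-1 * x)^-1 ^ x'^-1.
  by rewrite conjgE !invgM !invgK -!mulgA mulgV mulg1.
by apply: normal_subgroupP; exact: NV.
Qed.

Lemma quotient_mulA : associative quotient_mul.
Proof.
move=> p q r; rewrite -(reprK_coset p) -(reprK_coset q) -(reprK_coset r).
by rewrite !coset_mul mulgA.
Qed.

Lemma quotient_mul1 : left_id quotient_one quotient_mul.
Proof. by move=> p; rewrite -(reprK_coset p) coset_mul mul1g. Qed.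

Lemma quotient_mulr1 : right_id quotient_one quotient_mul.
Proof. by move=> p; rewrite -(reprK_coset p) coset_mul mulg1. Qed.

Lemma quotient_mulV : left_inverse quotient_one quotient_inv quotient_mul.
Proof. by move=> p; rewrite -(reprK_coset p) coset_inv coset_mul mulVg. Qed.

Lemma quotient_mulrV : right_inverse quotient_one quotient_inv quotient_mul.
Proof. by move=> p; rewrite -(reprK_coset p) coset_inv coset_mul mulgV. Qed.

HB.instance Definition _ := isGroup.Build quotient_group
  quotient_mulA quotient_mul1 quotient_mulr1 quotient_mulV quotient_mulrV.

End quotient_group.

Section topological_quotient.
Context {G : topologicalGroupType} (N : normal_subgroup G).
Local Open Scope quotient_scope.

HB.instance Definition _ := Topological.copy (quotient_group N)
  (quotient_topology {eq_quot (coset_equiv N)}).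

Lemma coset_continuous : continuous (@coset G N).
Proof. exact: (@pi_continuous G {eq_quot (coset_equiv N)}). Qed.

Lemma mulgr_continuous (y : G) : continuous (fun x : G => x * y).
Proof.
move=> x; apply: (@continuous_comp _ _ _ (fun x => (x, y))
  (fun z : G * G => z.1 * z.2)); last exact: mulg_continuous.
by apply: cvg_pair => /=; [exact: cvg_id|exact: cvg_cst].
Qed.

Lemma coset_open (A : set G) : open A -> open (@coset G N @` A).
Proof.
move=> oA; have -> : open (@coset G N @` A) =
  open (@coset G N @^-1` (@coset G N @` A)) by [].
rewrite (_ : _ @^-1` _ = \bigcup_(h in N) ((fun x => x * h) @^-1` A)).
  apply: bigcup_open => h _.
  by apply: open_comp => // x _; exact: mulgr_continuous.
apply/seteqP; split=> [x [a Aa /esym/cosetP Nxa]|x [h Nh Axh]].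
  by exists (x^-1 * a) => //=; rewrite mulVKg.
exists (x * h) => //; apply/esym/cosetP.
by rewrite mulKg.
Qed.

Lemma coset_nbhs (x : G) (A : set G) :
  nbhs x A -> nbhs (coset N x) (@coset G N @` A).
Proof.
rewrite !nbhsE => -[B [oB Bx] BA]; exists (@coset G N @` B).
  by split; [exact: coset_open|exists x].
exact: image_subset.
Qed.

Lemma quotient_mulg_continuous :
  continuous (fun p : quotient_group N * quotient_group N => p.1 * p.2
              : quotient_group N).
Proof.
move=> [p q] /= W nW.
rewrite -(reprK_coset p) -(reprK_coset q) in nW *.
set x := repr p in nW *; set y := repr q in nW *.
have cW : nbhs (x * y) (@coset G N @^-1` W).
  by apply: coset_continuous; rewrite -coset_mul.
have [[A B] /= [nA nB] AB] := @mulg_continuous G (x, y) _ cW.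
exists (@coset G N @` A, @coset G N @` B) => /=.
  by split; exact: coset_nbhs.
move=> [_ _] /= [[a Aa <-] [b Bb <-]].
have := AB (a, b) (conj Aa Bb) => /=.
by rewrite /= -coset_mul.
Qed.

Lemma quotient_invg_continuous :
  continuous (fun p : quotient_group N => p^-1).
Proof.
move=> p /= W nW; rewrite -(reprK_coset p) in nW *.
set x := repr p in nW *.
have cW : nbhs x^-1 (@coset G N @^-1` W).
  by apply: coset_continuous; rewrite -coset_inv.
have /coset_nbhs := @invg_continuous G x _ cW.
apply: filterS => _ [a /= Wa <-].
by move: Wa; rewrite -coset_inv.
Qed.

HB.instance Definition _ := isTopologicalGroup.Build (quotient_group N)
  quotient_mulg_continuous quotient_invg_continuous.

End topological_quotient.

Record tdlcsc (G : topologicalGroupType) : Prop := Tdlcsc {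
  tdlcsc_hausdorff : hausdorff_space G ;
  tdlcsc_totally_disconnected : totally_disconnected [set: G] ;
  tdlcsc_locally_compact : locally_compact [set: G] ;
  tdlcsc_second_countable : @second_countable G
}.

(* Convention: a profinite group is a compact totally disconnected Hausdorff
   topological group. *)
Record profinite (G : topologicalGroupType) : Prop := Profinite {
  profinite_hausdorff : hausdorff_space G ;
  profinite_totally_disconnected : totally_disconnected [set: G] ;
  profinite_compact : compact [set: G]
}.

Definition discrete (G : topologicalGroupType) := forall A : set G, open A.

(* Subgroups and quotients carry the subspace and the quotient topology. *)
Inductive elementary : topologicalGroupType -> Prop :=
| elementary_profinite (G : topologicalGroupType) :
    profinite G -> @second_countable G -> elementary G
| elementary_discrete (G : topologicalGroupType) :
    discrete G -> countable [set: G] -> elementary G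
| elementary_extension (G : topologicalGroupType) (N : normal_subgroup G) :
    tdlcsc G -> closed N -> elementary (subgroup_type N) ->
    profinite (quotient_group N) \/ discrete (quotient_group N) ->
    elementary G
| elementary_union (G : topologicalGroupType) (O : nat -> subgroup G) :
    tdlcsc G ->
    (forall i, open (O i)) -> (forall i, O i `<=` O i.+1) ->
    \bigcup_i O i = [set: G] ->
    (forall i, elementary (subgroup_type (O i))) ->
    elementary G.

Definition closed_set (G : topologicalType) := {F : set G | closed F}.

(* Effros Borel structure: generated by the sets of closed sets hitting a given
   open set. *)
Definition effros_borel (G : topologicalType) : set (set (closed_set G)) :=
  <<s [set [set F : closed_set G | sval F `&` O !=set0] | O in @open G] >>.

Definition borel (G : topologicalType) : set (set G) := <<s @open G >>.

Record selector_functions (G : topologicalType) := SelectorFunctions {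
  selector :> nat -> closed_set G -> G ;
  selector_borel : forall n B, borel B -> effros_borel (selector n @^-1` B) ;
  selector_in : forall (F : closed_set G) n, sval F !=set0 -> sval F (selector n F) ;
  selector_dense : forall F : closed_set G, sval F !=set0 ->
    sval F `<=` closure (range (selector^~ F))
}.

Record compact_open_subgroup (G : topologicalGroupType) := CompactOpenSubgroup {
  compact_open_subgroup_subgroup :> subgroup G ;
  compact_open_subgroup_compact : compact compact_open_subgroup_subgroup ;
  compact_open_subgroup_open : open compact_open_subgroup_subgroup
}.

Record closed_subgroup (G : topologicalGroupType) := ClosedSubgroup {
  closed_subgroup_subgroup :> subgroup G ;
  closed_subgroup_closed : closed closed_subgroup_subgroup
}.

Definition closed_subgroup_set (G : topologicalGroupType)
    (H : closed_subgroup G) : closed_set G :=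
  exist _ (H : set G) (@closed_subgroup_closed G H).

Definition residual (L : topologicalGroupType) : set L :=
  \bigcap_(N in [set N | [/\ open N, is_subgroup N & is_normal N]]) N.

Arguments residual : clear implicits.

(* The discrete residual of H computed in the group H, as a subset of G. *)
Definition Res (G : topologicalGroupType) (H : subgroup G) : set G :=
  val @` residual (subgroup_type H).

Section decomposition.
Context {G : topologicalGroupType}.
Variables (U : compact_open_subgroup G) (D : selector_functions G).

Definition R_ (n : nat) (H : closed_subgroup G) : subgroup G :=
  generated (((U : set G) `&` H) `|`
             [set D i (closed_subgroup_set H) | i in [set i | (i <= n)%N]]).

Lemma subset_R n (H : closed_subgroup G) : R_ n H `<=` H.
Proof.
have [H1 _ _] := subgroupP H.
move=> x; apply; split; first exact: subgroupP.
move=> y [[]//|[i _ <-]].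
by apply: (@selector_in G D (closed_subgroup_set H)); exists 1.
Qed.

Lemma open_subgroup_closed (L : topologicalGroupType) (N : set L) :
  is_subgroup N -> open N -> closed N.
Proof.
move=> [N1 NM NV] oN x clx.
have nx : nbhs x ((fun y : L => y^-1 * x) @^-1` N).
  apply: (@continuous_comp _ _ _ (fun y : L => (y^-1, x))
    (fun z : L * L => z.1 * z.2)).
  - by apply: cvg_pair; [exact: invg_continuous|exact: cvg_cst].
  - exact: mulg_continuous.
  - by rewrite /= mulVg; exact: open_nbhs_nbhs.
have [y [Ny /= Nyx]] := clx _ nx.
by rewrite -(mulVKg y x); exact: NM.
Qed.

Lemma R_closed n (H : closed_subgroup G) : closed (R_ n H).
Proof.
have [_ HM HV] := subgroupP H.
have [U1 _ _] := subgroupP U.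
have [_ RM _] := subgroupP (R_ n H).
move=> x clx.
have Hx : (H : set G) x.
  apply: (@closed_subgroup_closed G H) => B /clx [y [Ry By]].
  by exists y; split => //; exact: subset_R Ry.
have nx : nbhs x ((fun y : G => y^-1 * x) @^-1` U).
  apply: (@continuous_comp _ _ _ (fun y : G => (y^-1, x))
    (fun z : G * G => z.1 * z.2)).
  - by apply: cvg_pair; [exact: invg_continuous|exact: cvg_cst].
  - exact: mulg_continuous.
  - rewrite /= mulVg; apply: open_nbhs_nbhs; split => //.
    exact: compact_open_subgroup_open.
have [y [Ry /= Uyx]] := clx _ nx.
rewrite -(mulVKg y x); apply: RM => //.
move=> B [_ subB]; apply: subB; left; split => //.
by apply: HM => //; apply: HV; exact: subset_R Ry.
Qed.

Lemma Res_is_subgroup (H : subgroup G) : is_subgroup (Res H).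
Proof.
split.
- by exists 1; rewrite ?gmulf1// => N [_ [N1 _ _] _].
- move=> _ _ [x rx <-] [y ry <-]; exists (x * y); last by rewrite gmulfM.
  move=> N Np; have [_ [_ NM _] _] := Np.
  by apply: NM; [exact: rx|exact: ry].
- move=> _ [x rx <-]; exists x^-1; last by rewrite gmulfV.
  move=> N Np; have [_ [_ _ NV] _] := Np.
  by apply: NV; exact: rx.
Qed.

Lemma Res_closed (H : subgroup G) : closed H -> closed (Res H).
Proof.
move=> cH.
have : closed (residual (subgroup_type H)).
  by apply: closed_bigI => N [oN sN _]; exact: open_subgroup_closed.
move=> /closed_openC [O oO Oe] x clx.
have Hx : (H : set G) x.
  apply: cH => B /clx [y [[z _ <-] By]].
  by exists (val z); split => //; exact/set_mem/(valP z).
apply: contrapT => nRx.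
pose x' : subgroup_type H := exist _ x (mem_set Hx).
have Ox : O x.
  have : (~` residual (subgroup_type H)) x' by move=> rx; apply: nRx; exists x'.
  by rewrite -Oe.
have [y [[z rz <-] Oz]] := clx _ (open_nbhs_nbhs (conj oO Ox)).
have : (~` residual (subgroup_type H)) z by rewrite -Oe.
exact.
Qed.

Definition decomposition_step (H : closed_subgroup G) (n : nat) :
    closed_subgroup G :=
  @ClosedSubgroup G (Subgroup (Res_is_subgroup (R_ n H)))
    (@Res_closed (R_ n H) (@R_closed n H)).

Lemma is_subgroupT : is_subgroup [set: G]. Proof. by []. Qed.

Definition full_subgroup : closed_subgroup G :=
  @ClosedSubgroup G (Subgroup is_subgroupT) closedT.

(* G_s; the recursion is run for every s, but only the values at nodes s of the
   decomposition tree are ever used. *)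
Definition decomposition_subgroup (s : seq nat) : closed_subgroup G :=
  foldl decomposition_step full_subgroup s.

Inductive decomposition_tree : set (seq nat) :=
| decomposition_tree_nil : decomposition_tree [::]
| decomposition_tree_rcons s n :
    decomposition_tree s -> decomposition_subgroup s <> [set 1] :> set G ->
    decomposition_tree (rcons s n).

End decomposition.

Definition well_founded_tree (T : set (seq nat)) :=
  ~ exists a : nat -> nat, forall n, T (mkseq a n).

(* Main.v *)
Require Import Defs.
From mathcomp Require Import all_boot all_classical.
From mathcomp Require Import reals topology measurable_structure.

(* If L is generated by a compact set and has a compact open subgroup, its
   residual Q is cocompact in some open normal subgroup O: then L/O is discrete
   and O/Q is profinite, so L is elementary as soon as Q is.  Since H is the
   increasing union of the R_n(H), it is elementary when all the Res(R_n(H))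
   are; hence a non-elementary G yields an infinite branch.  Conversely, let H
   inject continuously into an elementary group E.  A homomorphism into a
   discrete or profinite group kills residuals, and a compactly generated group
   mapping into an increasing union of open subgroups lands in one of them, so
   Res(R_n(H)) is trivial or injects into one of the groups from which E was
   constructed; induction on E excludes infinite branches. *)

Set Implicit Arguments.
Unset Strict Implicit.
Unset Printing Implicit Defensive.

Local Open Scope classical_set_scope.
Local Open Scope group_scope.

(** * Topological embeddings and zero-dimensional spaces *)

Section topology_facts.
Implicit Types X Y Z : topologicalType.

(** The second clause says that [X] carries the initial topology along [f]. Groups embedded in [G]
    with a prescribed range stand for subgroups below, so that nested subgroups need no transport
    along isomorphisms. *)
Definition embedding X Y (f : X -> Y) :=
  injective f /\ forall A, open A <-> exists2 B, open B & f @^-1` B = A.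

Lemma embedding_continuous X Y (f : X -> Y) : embedding f -> continuous f.
Proof. by case=> _ fo; apply/continuousP => A oA; apply/fo; exists A. Qed.

Lemma embedding_comp X Y Z (f : X -> Y) (g : Y -> Z) :
  embedding f -> embedding g -> embedding (g \o f).
Proof.
move=> [fI fo] [gI go]; split=> [|A]; first exact: inj_comp.
split=> [/fo[B /go[C oC <-] <-]|[C oC <-]]; first by exists C.
by apply/fo; exists (g @^-1` C) => //; apply/go; exists C.
Qed.

(** A cluster point in [K] of the image filter has a preimage, as [K] lies in the range; that
    preimage is a cluster point because open sets of [X] are pulled back from [Y]. *)
Lemma embedding_compact X Y (f : X -> Y) (K : set Y) :
  embedding f -> compact K -> K `<=` range f -> compact (f @^-1` K).
Proof.
move=> [fI fo] cK Kf F PF FK.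
have [y [Ky cly]] := cK (f @ F) _ FK; have [x _ fxy] := Kf _ Ky.
exists x; split; first by rewrite /preimage/= fxy.
move=> A B FA; rewrite nbhsE => -[_ [/fo[C oC <-] /= Cfx] CB].
rewrite fxy in Cfx.
have [_ [[a Aa <-] Cfa]] : (f @` A) `&` C !=set0.
  apply: cly; last exact: open_nbhs_nbhs.
  rewrite /fmap/= nbhs_simpl.
  by apply: (filterS (P := A)) FA => a Aa; exists a.
by exists a; split => //; exact: CB.
Qed.

Lemma embedding_closed_tdlcsc (X Y : topologicalGroupType) (f : X -> Y) :
  embedding f -> closed (range f) -> tdlcsc Y -> tdlcsc X.
Proof.
move=> ef cf [hY tdY lcY [B cB [oB nB]]].
have [fI fo] := ef; have cof := embedding_continuous ef.
split.
- move=> x y clxy; apply: fI; apply: hY => A C nA nC.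
  have [z [Az Cz]] := clxy _ _ (cof _ _ nA) (cof _ _ nC).
  by exists (f z).
- move=> x _; apply/seteqP; split=> [z [C [Cx _ cC] Cz]|_ ->]; last first.
    exact: connected_component_refl.
  apply: fI.
  have : connected_component [set: Y] (f x) (f z).
    exists (f @` C); last by exists z.
    split=> //.
    exact/(connected_continuous_connected cC)/continuous_subspaceT.
  by rewrite tdY.
- move=> x _; have [K nK [cK clK]] := lcY (f x) I.
  exists (f @^-1` K).
    have nfK : nbhs (f x) K by rewrite within_interior ?interiorT in nK.
    by rewrite within_interior ?interiorT//; exact: cof.
  split; last by apply: preimage_closed => // ? _; exact: cof.
  (* Cutting [K] down to the closed range keeps it compact and makes [embedding_compact]
     applicable. *)
  rewrite (_ : _ @^-1` _ = f @^-1` (range f `&` K)).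
    by apply: embedding_compact => //; rewrite setIC; exact: compact_closedI.
  by apply/seteqP; split=> z /=; [move=> Kz; split=> //; exists z|case].
- exists [set f @^-1` A | A in B]; first exact: (sub_countable (card_image_le _ _)).
  split=> [_ [A BA <-]|x A]; first by apply/fo; exists A => //; exact: oB.
  rewrite nbhsE => -[_ [/fo[C oC <-] /= Cfx] CA].
  have [E [BE Efx] EC] := nB _ _ (open_nbhs_nbhs (conj oC Cfx)).
  exists (f @^-1` E); first by split=> //; exists E.
  by move=> z /= /EC; exact: CA.
Qed.

Lemma zero_dimensional_hausdorff X : zero_dimensional X -> hausdorff_space X.
Proof.
move=> zX x y clxy; apply: contrapT => /eqP /zX[U [[oU cU] Ux Uy]].
have [z [Uz]] := clxy U (~` U) (open_nbhs_nbhs (conj oU Ux))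
  (open_nbhs_nbhs (conj (closed_openC cU) Uy)).
exact.
Qed.

(* In a compact Hausdorff space the intersection Q of all clopen sets
   containing x is connected: if A is relatively clopen in Q, choose an open V
   around A whose closure misses Q \ A; the boundary of V is compact and misses
   Q, hence misses some clopen C containing x, so C splits along V. *)
Lemma compact_totally_disconnected_zero_dimensional X :
  hausdorff_space X -> compact [set: X] -> totally_disconnected [set: X] ->
  zero_dimensional X.
Proof.
move=> hX cX tX x y /eqP xy; apply: contrapT => nxy; apply: xy.
pose F := [set C : set X | clopen C /\ C x].
pose Q := \bigcap_(C in F) C.
have Qx : Q x by move=> C [].
suff cQ : connected Q.
  suff : connected_component [set: X] x y by rewrite tX.
  exists Q; first by split.
  by move=> C [cC Cx]; apply: contrapT => Cy; apply: nxy; exists C.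
have clQ : closed Q by apply: closed_bigI => C [[]].
(* If every member of [F] met [K], the traces on [K] would generate a proper filter, and a cluster
   point of it would lie in both [Q] and [K]. *)
have small K : closed K -> Q `&` K = set0 -> exists2 C, F C & C `&` K = set0.
  move=> clK QK; apply: contrapT => nC.
  have FF : ProperFilter (filter_from F (fun C => C `&` K)).
    apply: filter_from_proper; last first.
      by move=> C FC; apply/set0P/eqP => CK; apply: nC; exists C.
    apply: filter_from_filter; first by exists setT; split => //; exact: clopenT.
    move=> A B [cA Ax] [cB Bx]; exists (A `&` B).
      by split=> //; exact: clopenI.
    by move=> z [[]].
  have [|z [_ clz]] := cX _ FF; first by exists setT => //; split=> //; exact: clopenT.
  have [Qz Kz] : (Q `&` K) z.
    split=> [C FC|]; [have [[_ +] _] := FC|move: clK]; apply.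
      by move=> B; apply: clz; exists C => // ? [].
    move=> B; apply: clz; exists setT => [|?[]//].
    by split=> //; exact: clopenT.
  by have : (Q `&` K) z by []; rewrite QK.
move=> A A0 [O oO AO] [D clD AD].
have clA : closed A by rewrite AD; exact: closedI.
have nA : set_nbhs A (~` (Q `\` O)).
  apply/set_nbhsP; exists (~` (Q `\` O)); split => //.
    by apply: closed_openC; rewrite setDE; apply: closedI => //; exact: open_closedC.
  by rewrite AO => z [Qz Oz] [_]; exact.
have [W /set_nbhsP[V [oV AV VW]] WO] := compact_normal hX cX clA nA.
have [C [[oC clC] Cx] CV] : exists2 C, F C & C `&` (closure V `\` V) = set0.
  apply: small.
    by rewrite setDE; apply: closedI; [exact: closed_closure|exact: open_closedC].
  apply/seteqP; split => // z [Qz [clVz nVz]].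
  have := WO _ (closureS VW clVz); apply; split=> // Oz.
  by apply: nVz; apply: AV; rewrite AO.
have CVE : C `&` V = C `&` closure V.
  apply/seteqP; split=> z [Cz Vz]; split=> //; first exact: subset_closure.
  apply: contrapT => nVz.
  by have : (C `&` (closure V `\` V)) z by []; rewrite CV.
have cCV : clopen (C `&` V).
  by split; [exact: openI|rewrite CVE; apply: closedI => //; exact: closed_closure].
apply/seteqP; split; first by rewrite AO => ? [].
(* [Q] lies in whichever of [C] [&] [V] and its complement contains [x]; the first case gives [A] =
   [Q], the second contradicts that [A] is nonempty. *)
have [Vx z Qz|nVx] := pselect (V x).
  have [_ Vz] : (C `&` V) z by apply: Qz; split.
  rewrite AO; split=> //; apply: contrapT => Oz.
  have := WO _ (closureS VW (subset_closure Vz)); apply; split => //.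
have [z Az] := A0.
have [] : (~` (C `&` V)) z.
  have Qz : Q z by move: Az; rewrite AO => -[].
  by apply: Qz; split; [exact: clopenC|case].
split; last exact: AV.
by move: Az; rewrite AO => -[Qz _]; apply: Qz.
Qed.

End topology_facts.

(** * Discrete residuals *)

Section group_facts.
Implicit Types G H K L : topologicalGroupType.

Lemma hom1 (G H : groupType) (f : G -> H) : {morph f : x y / x * y} -> f 1 = 1.
Proof. by move=> fM; apply: (mulgI (f 1)); rewrite -fM !mulg1. Qed.

Lemma homV (G H : groupType) (f : G -> H) :
  {morph f : x y / x * y} -> {morph f : x / x^-1}.
Proof.
by move=> fM x; apply: (mulgI (f x)); rewrite -fM !mulgV hom1.
Qed.

Lemma homJ (G H : groupType) (f : G -> H) :
  {morph f : x y / x * y} -> {morph f : x y / x ^ y}.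
Proof. by move=> fM x y; rewrite !conjgE !fM homV. Qed.

Lemma preimage_is_subgroup (G H : groupType) (f : G -> H) (A : set H) :
  {morph f : x y / x * y} -> is_subgroup A -> is_subgroup (f @^-1` A).
Proof.
move=> fM [A1 AM AV]; split=> [|x y|x]; rewrite /preimage/= ?fM ?homV ?hom1//.
  exact: AM.
exact: AV.
Qed.

Lemma image_is_subgroup (G H : groupType) (f : G -> H) (A : set G) :
  {morph f : x y / x * y} -> is_subgroup A -> is_subgroup (f @` A).
Proof.
move=> fM [A1 AM AV]; split=> [|_ _ [x Ax <-] [y Ay <-]|_ [x Ax <-]].
- by exists 1; rewrite ?hom1.
- by exists (x * y); [exact: AM|rewrite fM].
- by exists x^-1; [exact: AV|rewrite homV].
Qed.

Lemma preimage_is_normal (G H : groupType) (f : G -> H) (A : set H) :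
  {morph f : x y / x * y} -> is_normal A -> is_normal (f @^-1` A).
Proof. by move=> fM nA x g; rewrite /preimage/= homJ//; exact: nA. Qed.

Lemma subgroup_embedding G (A : subgroup G) :
  embedding (val : subgroup_type A -> G).
Proof. by split=> [|B]; [exact: val_inj|]. Qed.

Lemma subgroup_valM G (A : subgroup G) :
  {morph (val : subgroup_type A -> G) : x y / x * y}.
Proof. exact: gmulfM. Qed.

Lemma range_subgroup_val G (A : subgroup G) :
  range (val : subgroup_type A -> G) = A.
Proof.
apply/seteqP; split=> [_ [x _ <-]|x Ax]; first exact/set_mem/(valP x).
by exists (exist _ x (mem_set Ax)).
Qed.

Lemma subgroup_mem G (A : subgroup G) (x : subgroup_type A) :
  (A : set G) (val x).
Proof. exact/set_mem/(valP x). Qed.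

Lemma generated_min (G : groupType) (A B : set G) :
  is_subgroup B -> A `<=` B -> generated A `<=` B.
Proof. by move=> sB AB x; apply. Qed.

Lemma subset_generated (G : groupType) (A : set G) : A `<=` generated A.
Proof. by move=> x Ax B [_]; apply. Qed.

Lemma mulgl_continuous G (y : G) : continuous (fun x : G => y * x).
Proof.
move=> x; apply: (@continuous_comp _ _ _ (fun x => (y, x))
  (fun z : G * G => z.1 * z.2)); last exact: mulg_continuous.
by apply: cvg_pair => /=; [exact: cvg_cst|exact: cvg_id].
Qed.

Lemma cvg_mulg G T (F : set_system T) (f g : T -> G) (a b : G) : Filter F ->
  f @ F --> a -> g @ F --> b -> (fun x => f x * g x) @ F --> a * b.
Proof.
move=> FF fa gb; apply: (@cvg_comp _ _ _ (fun x => (f x, g x))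
  (fun z : G * G => z.1 * z.2)); last exact: (@mulg_continuous G (a, b)).
exact: cvg_pair.
Qed.

Lemma open_subgroupS G (A B : set G) :
  is_subgroup B -> open A -> A 1 -> A `<=` B -> open B.
Proof.
move=> [B1 BM BV] oA A1 AB; rewrite openE => x Bx.
rewrite /interior nbhsE; exists ((fun y => x^-1 * y) @^-1` A).
  split; last by rewrite /preimage/= mulVg.
  by apply: open_comp => // y _; exact: mulgl_continuous.
by move=> y /AB By; rewrite -(mulVKg x y); exact: BM.
Qed.

(** Open normal subgroups of [H] pull back to open normal subgroups of [G]. *)
Lemma residual_hom G H (f : G -> H) : continuous f -> {morph f : x y / x * y} ->
  forall x, residual G x -> residual H (f x).
Proof.
move=> cf fM x rx N [oN sN nN]; apply: (rx (f @^-1` N)); split.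
- by apply: open_comp => // y _; exact: cf.
- exact: preimage_is_subgroup.
- exact: preimage_is_normal.
Qed.

Lemma residual_is_subgroup G : is_subgroup (residual G).
Proof.
split=> [N [_ []]//|x y rx ry N NP|x rx N NP]; have [_ [_ NM NV] _] := NP.
  by apply: NM; [exact: rx|exact: ry].
by apply: NV; exact: rx.
Qed.

Lemma residual_is_normal G : is_normal (residual G).
Proof. by move=> x g rx N NP; have [_ _ nN] := NP; apply: nN; exact: rx. Qed.

Lemma residual_closed G : closed (residual G).
Proof.
by apply: closed_bigI => N [oN sN _]; exact: open_subgroup_closed.
Qed.

Lemma discrete_residual G : discrete G -> residual G `<=` [set 1].
Proof.
move=> dG x; apply; split=> //; first split=> [//|x' y -> ->|x' ->].
- by rewrite mulg1.
- by rewrite invg1.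
by move=> _ g ->; rewrite conj1g.
Qed.

(* The elements leaving invariant all the two-sided translates of a clopen set K
   form a normal subgroup, open by compactness. *)
Lemma profinite_residual G : profinite G -> residual G `<=` [set 1].
Proof.
move=> [hG tG cG] x rx; apply: contrapT => /eqP; rewrite eq_sym => x1.
have [K [[oK clK] K1 nKx]] :=
  compact_totally_disconnected_zero_dimensional hG cG tG x1.
pose N := [set x | forall a b, K (a * x * b) <-> K (a * b)].
suff rN : N x by apply: nKx; rewrite -(mul1g x) -(mulg1 (1 * x)) rN mulg1.
apply: rx; split; last 2 first.
- split=> [a b|y z Ny Nz a b|y Ny a b]; first by rewrite mulg1.
    by rewrite mulgA -(mulgA (a * y)) Ny mulgA Nz.
  by rewrite -Ny mulgVK.
- move=> y g Ny a b; rewrite conjgE.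
  rewrite (_ : a * _ * b = (a * g^-1) * y * (g * b)) ?Ny; last by rewrite !mulgA.
  by rewrite -mulgA mulKg.
rewrite openE => y Ny.
have cGG : compact [set: G * G] by rewrite -setXTT; exact: compact_setX.
(* Membership in the clopen set [K] is locally constant; compactness of [G * G] then yields a
   neighbourhood of [y] that works for all pairs [(a, b)] at once. *)
have nK z : \forall z' \near z, K z' <-> K z.
  have [Kz|nKz] := pselect (K z).
    by apply: filterS (open_nbhs_nbhs (conj oK Kz)) => z'.
  by apply: filterS (open_nbhs_nbhs (conj (closed_openC clK) nKz)) => z'.
have /compact_near_coveringP cov := cGG.
suff sub : \forall y' \near y,
    [set: G * G] `<=` fun ab => K (ab.1 * y' * ab.2) <-> K (ab.1 * ab.2).
  by apply: filterS sub => z Nz a b; exact: (Nz (a, b)).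
apply: cov => -[a b] _.
have ca : fst \o fst @ filter_prod (nbhs (a, b)) (nbhs y) --> a.
  by apply: cvg_comp; [exact: cvg_fst|exact: cvg_fst].
have cb : snd \o fst @ filter_prod (nbhs (a, b)) (nbhs y) --> b.
  by apply: cvg_comp; [exact: cvg_fst|exact: cvg_snd].
have cy : snd @ filter_prod (nbhs (a, b)) (nbhs y) --> y by exact: cvg_snd.
have FF : Filter (filter_prod (nbhs (a, b)) (nbhs y)) by exact: filter_prod_filter.
have n1 := cvg_mulg FF (cvg_mulg FF ca cy) cb (nK _).
have n2 := cvg_mulg FF ca cb (nK _).
apply: (@filterS2 _ _ FF _ _ _ _ n1 n2).
by move=> [[a' b'] y'] /= -> ->; exact: Ny.
Qed.

(** Composing [f] with the quotient map sends the residual into that of the quotient, which is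
    trivial. *)
Lemma residual_sub_kernel G H (N : normal_subgroup H) (f : G -> H) :
  continuous f -> {morph f : x y / x * y} ->
  profinite (quotient_group N) \/ discrete (quotient_group N) ->
  residual G `<=` f @^-1` N.
Proof.
move=> cf fM pd x rx.
have q1 : residual (quotient_group N) (coset N (f x)).
  apply: (residual_hom (f := fun x => coset N (f x))) => //.
    by move=> y; apply: continuous_comp; [exact: cf|exact: coset_continuous].
  by move=> y z; rewrite fM -coset_mul.
have /cosetP : coset N 1 = coset N (f x).
  symmetry; case: pd => [/profinite_residual|/discrete_residual]; exact.
by rewrite invg1 mul1g.
Qed.

End group_facts.

(** * Compactly generated groups *)

Section compact_generation.
Variable M : topologicalGroupType.

(** Open normal subgroups are stable under finite intersection. If none worked, their traces on [K]
    minus [W] would cluster at a point lying in every one of them, as they are closed, hence in the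
    residual and in the open set [W], which is absurd. *)
Lemma open_normal_near_residual (K W : set M) :
  compact K -> open W -> residual M `<=` W ->
  exists N : set M, [/\ open N, is_subgroup N, is_normal N & N `&` K `<=` W].
Proof.
move=> cK oW QW; apply: contrapT => nN.
pose D := [set N : set M | [/\ open N, is_subgroup N & is_normal N]].
have DT : D setT by split=> //; exact: openT.
have FF : ProperFilter (filter_from D (fun N => (N `&` K) `\` W)).
  apply: filter_from_proper => [|N [oN sN nNN]]; last first.
    apply/set0P/eqP => NW; apply: nN; exists N; split=> // x NKx.
    apply: contrapT => nWx.
    by have : ((N `&` K) `\` W) x by []; rewrite NW.
  apply: filter_from_filter => [|A B [oA [A1 AM AV] nA] [oB [B1 BM BV] nB]].
    by exists setT.
  exists (A `&` B); last by move=> x [[[Ax Bx] Kx] nWx].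
  split; [exact: openI| |by move=> x g [Ax Bx]; split; [exact: nA|exact: nB]].
  split=> [//|x y [Ax Bx] [Ay By]|x [Ax Bx]].
    by split; [exact: AM|exact: BM].
  by split; [exact: AV|exact: BV].
have [|x [Kx clx]] := cK _ FF; first by exists setT => // x [[]].
have : W x.
  apply: QW => N [oN sN nNN]; apply: (open_subgroup_closed sN oN) => B.
  by apply: clx; exists N => // y [[]].
move=> Wx; have [|y [nWy Wy]] := clx (~` W) W _ (open_nbhs_nbhs (conj oW Wx)).
  by exists setT => // y [].
exact: nWy.
Qed.

Variable V : compact_open_subgroup M.

(** The product set QV, where Q is the residual of [M]. *)
Definition residual_mul : set M :=
  [set x | exists2 q, residual M q & (V : set M) (q^-1 * x)].

Lemma residual_mul_is_subgroup : is_subgroup residual_mul.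
Proof.
have [R1 RM RV] := residual_is_subgroup M.
have RJ := @residual_is_normal M.
have [V1 VM VV] := subgroupP V.
split=> [|x y [p Rp Vx] [q Rq Vy]|x [q Rq Vx]].
- by exists 1; rewrite ?mulg1 ?invg1.
(* With x = pv and y = qw, normality of the residual gives xy = p (v q v^-1) (v w). *)
- exists (p * q ^ (p^-1 * x)^-1); first by apply: RM => //; exact: RJ.
  rewrite (_ : _ * _ = (p^-1 * x) * (q^-1 * y)); first exact: VM.
  by rewrite conjgE invgK !invgM !invgK !mulgA ?(mulgK, mulgVK).
- exists (q^-1 ^ (q^-1 * x)); first by apply: RJ; exact: RV.
  rewrite (_ : _ * _ = (q^-1 * x)^-1); first exact: VV.
  by rewrite conjgE !invgM !invgK !mulgA ?(mulgK, mulgVK).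
Qed.

Lemma residual_sub_mul : residual M `<=` residual_mul.
Proof. by move=> x Rx; exists x => //; rewrite mulVg; case: (subgroupP V). Qed.

Lemma residual_mul_open : open residual_mul.
Proof.
apply: (open_subgroupS residual_mul_is_subgroup (compact_open_subgroup_open V)).
  by case: (subgroupP V).
move=> x Vx; exists 1; first by case: (residual_is_subgroup M).
by rewrite invg1 mul1g.
Qed.

(* Caprace and Monod: with Q the residual and N an open normal subgroup such
   that N \cap (V^c \cup V^(c^-1)) lies in QV for all c in C, the group
   N \cap QV = Q (N \cap V) is normalized by C. *)
Lemma compactly_generated_residual (C : set M) : compact C ->
  (forall A, is_subgroup A -> C `<=` A -> A = setT) ->
  exists O : normal_subgroup M,
    [/\ open O, residual M `<=` O & O `<=` residual_mul].
Proof.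
move=> cC genC.
have [R1 RM RV] := residual_is_subgroup M.
have RJ := @residual_is_normal M.
have [S1 SM SV] := residual_mul_is_subgroup.
have [V1 VM VV] := subgroupP V.
(* The conjugates of [V] by elements of [C] ([J true]) and by their inverses ([J false]), as images
   of a compact product. *)
pose J e := [set (if e then x.1 ^ x.2 else x.1 ^ x.2^-1) | x in (V : set M) `*` C].
have cJ e : compact (J e).
  apply: continuous_compact.
    apply: continuous_subspaceT => -[x c].
    have cc : (fun z : M * M => if e then z.2 else z.2^-1) z @[z --> (x, c)]
        --> (if e then c else c^-1).
      case: e; first exact: cvg_snd.
      by apply: cvg_comp; [exact: cvg_snd|exact: invg_continuous].
    have cci : (fun z : M * M => (if e then z.2 else z.2^-1)^-1) z @[z --> (x, c)]
        --> (if e then c else c^-1)^-1.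
      by apply: cvg_comp; [exact: cc|exact: invg_continuous].
    have := cvg_mulg _ cci (cvg_mulg _ (@cvg_fst _ _ (nbhs x) (nbhs c) _) cc).
    by case: e {cc cci} => /= h; apply: h.
  by apply: compact_setX => //; exact: compact_open_subgroup_compact.
have [N [oN sN nN NJ]] := open_normal_near_residual
  (compactU (cJ true) (cJ false)) residual_mul_open residual_sub_mul.
have [N1 NM NV] := sN.
have RN : residual M `<=` N by move=> x; apply.
pose O := N `&` residual_mul.
have sO : is_subgroup O.
  split=> [//|x y [Nx Sx] [Ny Sy]|x [Nx Sx]].
    by split; [exact: NM|exact: SM].
  by split; [exact: NV|exact: SV].
(* Write x = qv with q in the residual: the conjugate of q stays in the residual, and v lies in [N],
   so the choice of [N] puts the conjugate of v in [residual_mul]. *)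
have JO e c x : C c -> O x -> O (x ^ (if e then c else c^-1)).
  move=> Cc [Nx [q Rq Vqx]]; split; first exact: nN.
  rewrite -(mulVKg q x) conjMg; apply: SM.
    by apply: residual_sub_mul; exact: RJ.
  apply: NJ; split; first by apply: nN; apply: NM => //; exact/NV/RN.
  by case: e; [left|right]; exists (q^-1 * x, c).
have nO : is_normal O.
  (* Asking for both [g] and [g^-1] makes [B] closed under inverses, so it is a subgroup containing
     [C]. *)
  pose B := [set g | forall x, O x -> O (x ^ g) /\ O (x ^ g^-1)].
  suff BT : B = setT by move=> x g Ox; have Bg : B g by [rewrite BT]; have [] := Bg x Ox.
  apply: genC; last by move=> c Cc x Ox; split; [exact (JO true c x Cc Ox)|exact (JO false c x Cc Ox)].
  split=> [x|g h Bg Bh x Ox|g Bg x /Bg[]]; last by rewrite invgK.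
    by rewrite invg1 conjg1.
  rewrite invgM !conjgM; split.
    by have [Og _] := Bg x Ox; have [] := Bh _ Og.
  by have [_ Oh] := Bh x Ox; have [] := Bg _ Oh.
exists (@NormalSubgroup M (Subgroup sO) nO); split => /=.
- exact: openI residual_mul_open.
- by move=> x Rx; split; [exact: RN|exact: residual_sub_mul].
- by move=> x [].
Qed.

End compact_generation.

Lemma discrete_quotient (G : topologicalGroupType) (N : normal_subgroup G) :
  open N -> discrete (quotient_group N).
Proof.
move=> oN A; rewrite (_ : A = coset N @` (coset N @^-1` A)); last first.
  apply/seteqP; split=> [q Aq|_ [x Ax <-]//].
  by exists (repr q); rewrite /preimage/= reprK_coset.
apply: coset_open; rewrite openE => x Ax; rewrite /interior nbhsE.
exists ((fun y => x^-1 * y) @^-1` N).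
  split; first by apply: open_comp => // y _; exact: mulgl_continuous.
  by rewrite /preimage/= mulVg; case: (subgroupP N).
by move=> y /cosetP xy; rewrite /preimage/= -xy.
Qed.

(** Two extensions, first by [O] and then by the residual. The last hypothesis ranges over all
    embedded copies of the residual, since the copy met here is a subgroup of [subgroup_type O]. *)
Lemma elementary_compactly_generated (M : topologicalGroupType)
    (V : compact_open_subgroup M) (C : set M) :
  tdlcsc M -> compact C ->
  (forall A, is_subgroup A -> C `<=` A -> A = setT) ->
  (forall (L : topologicalGroupType) (f : L -> M),
     {morph f : x y / x * y} -> embedding f -> range f = residual M ->
     elementary L) ->
  elementary M.
Proof.
move=> tM cC genC eR.
have [O [oO RO ORV]] := compactly_generated_residual V cC genC.
have [R1 RM RV] := residual_is_subgroup M.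
have clO : closed O by apply: open_subgroup_closed => //; exact: subgroupP.
apply: (elementary_extension tM clO); last by right; exact: discrete_quotient.
have vM : {morph (val : subgroup_type O -> M) : x y / x * y}.
  exact: subgroup_valM.
have ve := subgroup_embedding O.
have vc := embedding_continuous ve.
have sQ := preimage_is_subgroup vM (residual_is_subgroup M).
have nQ := preimage_is_normal vM (@residual_is_normal M).
pose Q : normal_subgroup (subgroup_type O) := @NormalSubgroup _ (Subgroup sQ) nQ.
apply: (@elementary_extension _ Q).
- by apply: (embedding_closed_tdlcsc ve) => //; rewrite range_subgroup_val.
- by apply: preimage_closed => [x _|]; [exact: vc|exact: residual_closed].
- apply: (eR _ ((val : subgroup_type O -> M) \o (val : subgroup_type Q -> subgroup_type O))).
  + by [].
  + by apply: embedding_comp => //; exact: subgroup_embedding.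
  + apply/seteqP; split; first by move=> _ [x _ <-]; exact: (subgroup_mem x).
    move=> x Rx; have : range (val : subgroup_type O -> M) x.
      by rewrite range_subgroup_val; exact: RO.
    case=> y _ yx; have Qy : (Q : set (subgroup_type O)) y.
      by rewrite /= /preimage/= yx.
    by exists (exist _ y (mem_set Qy)).
left.
(* Distinct cosets of x and y are separated by an open normal [N] of [M] omitting x^-1 y: the trace
   of xN on [O] is clopen and saturated for [Q], because [N] contains the residual. *)
have zQ : zero_dimensional (quotient_group Q).
  move=> p q; rewrite -(reprK_coset p) -(reprK_coset q).
  set x := repr p; set y := repr q => /eqP xy.
  have : ~ residual M (val (x^-1 * y)) by move=> Rxy; apply/xy/cosetP.
  move=> /existsNP[N /not_implyP[[oN sN nN] Nxy]].
  have [N1 NM NV] := sN.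
  pose A := (fun z : subgroup_type O => x^-1 * z) @^-1` (val @^-1` N).
  have oA : clopen A.
    apply: (preimage_clopen (f := fun z => x^-1 * z)); last first.
      exact: mulgl_continuous.
    apply: (preimage_clopen (f := val : subgroup_type O -> M)) => //.
    by split=> //; exact: open_subgroup_closed.
  have Acoset : coset Q @^-1` (coset Q @` A) = A.
    apply/seteqP; split=> [z [a Aa /cosetP Qaz]|z Az]; last by exists z.
    rewrite /A /preimage/= -(mulVKg a z) mulgA subgroup_valM.
    by apply: NM => //; exact: Qaz.
  exists (coset Q @` A); split.
  - split; first by apply: coset_open; case: oA.
    rewrite -openC.
    change (open (coset Q @^-1` ~` (coset Q @` A))).
    by have [_ /closed_openC] := oA; rewrite -{1}Acoset.
  - by exists x => //; rewrite /A/preimage/= mulVg; exact: N1.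
  - move=> Ay; apply: Nxy.
    have : (coset Q @^-1` (coset Q @` A)) y by [].
    by rewrite Acoset.
split; [exact: zero_dimensional_hausdorff|exact: zero_dimension_totally_disconnected|].
(* As [O] lies in [residual_mul V], every coset of [Q] meets the compact set [V] [&] [O]. *)
rewrite (_ : setT = coset Q @` (val @^-1` ((V : set M) `&` O))).
  apply: continuous_compact.
    by apply: continuous_subspaceT; exact: coset_continuous.
  apply: embedding_compact => //.
    by apply: compact_closedI => //; exact: compact_open_subgroup_compact.
  by rewrite range_subgroup_val => x [].
apply/seteqP; split=> // q _; rewrite -(reprK_coset q); set x := repr q.
have [r Rr Vrx] := ORV _ (subgroup_mem x).
have [r' _ rr'] : range (val : subgroup_type O -> M) r.
  by rewrite range_subgroup_val; exact: RO.
have vrx : val (r'^-1 * x) = r^-1 * val x by rewrite vM homV// rr'.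
exists (r'^-1 * x).
  by split; [rewrite vrx|exact: subgroup_mem].
apply/cosetP; rewrite invgM invgK -mulgA -conjgE.
have Qr : (Q : set _) r' by rewrite /preimage/= rr'.
exact: (@normal_subgroupP _ Q _ _ Qr).
Qed.

(** * From well-foundedness to elementarity *)

Section decomposition.
Context {G : topologicalGroupType}.
Variables (U : compact_open_subgroup G) (D : selector_functions G).

Local Notation R := (R_ U D).

Lemma subset_R_trace n (H : closed_subgroup G) : (U : set G) `&` H `<=` R n H.
Proof. by move=> x UHx; apply: subset_generated; left. Qed.

Lemma selector_R n i (H : closed_subgroup G) : (i <= n)%N ->
  (R n H : set G) (D i (closed_subgroup_set H)).
Proof. by move=> le_in; apply: subset_generated; right; exists i. Qed.

Lemma R_increasing n (H : closed_subgroup G) : R n H `<=` R n.+1 H.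
Proof.
apply: generated_min; first exact: subgroupP.
move=> x [UHx|[i le_in <-]]; first exact: subset_R_trace.
by apply: selector_R; exact: leqW.
Qed.

(** By density some selected point d of [H] lies in the neighbourhood xU of x, and then x differs
    from d by an element of [U] [&] [H]. *)
Lemma bigcup_R (H : closed_subgroup G) : H `<=` \bigcup_n R n H.
Proof.
move=> x Hx; have [H1 HM HV] := subgroupP H.
have nU : nbhs x ((fun y => x^-1 * y) @^-1` U).
  apply: open_nbhs_nbhs; split.
    by apply: open_comp => [y _|]; [exact: mulgl_continuous|exact: compact_open_subgroup_open].
  by rewrite /preimage/= mulVg; case: (subgroupP U).
have H0 : sval (closed_subgroup_set H) !=set0 by exists 1.
have [_ [[n _ <-] /= Ud]] := @selector_dense _ D _ H0 _ Hx _ nU.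
exists n => //; have [_ RM RV] := subgroupP (R n H).
set d := D n _ in Ud.
have Hd : (H : set G) d by exact: (@selector_in _ D _ n H0).
have -> : x = d * (x^-1 * d)^-1 by rewrite invgM invgK mulVKg.
apply: RM; first exact: (@selector_R n n H (leqnn n)).
apply: RV; apply: subset_R_trace; split=> //.
by apply: HM => //; exact: HV.
Qed.

(** Named apart because both implications rely on the compactness of this generating set of
    [R n H]. *)
Definition R_generators n (H : closed_subgroup G) : set G :=
  ((U : set G) `&` H) `|`
  [set D i (closed_subgroup_set H) | i in [set i | (i <= n)%N]].

Lemma R_generators_compact n (H : closed_subgroup G) :
  compact (R_generators n H).
Proof.
apply: compactU.
  apply: compact_closedI; first exact: compact_open_subgroup_compact.
  exact: closed_subgroup_closed.
apply: finite_compact; apply: finite_image; apply: sub_finite_set (finite_II n.+1).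
by move=> i /=; rewrite ltnS.
Qed.

(** The corestriction [g] of [f] and its inverse [h] are continuous homomorphisms, so [residual_hom]
    applies in both directions. *)
Lemma Res_iso (H : subgroup G) (L : topologicalGroupType) (f : L -> G) :
  {morph f : x y / x * y} -> embedding f -> range f = H ->
  f @` residual L = Res H.
Proof.
move=> fM ef fH; have [fI fo] := ef.
have fmem x : f x \in subgroup_set H by apply/mem_set; rewrite -fH; exists x.
pose g x : subgroup_type H := exist _ (f x) (fmem x).
have gM : {morph g : x y / x * y} by move=> x y; apply: val_inj; rewrite /= fM.
have gc : continuous g by apply: continuous_to_subgroup; exact: embedding_continuous.
have gS (y : subgroup_type H) : exists x, f x = val y.
  have : (H : set G) `<=` range f by rewrite fH.
  by move=> /(_ (val y) (subgroup_mem y))[x _ xy]; exists x.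
pose h y := projT1 (cid (gS y)).
have hK y : f (h y) = val y by rewrite /h; case: cid.
have hM : {morph h : x y / x * y}.
  by move=> x y; apply: fI; rewrite fM !hK subgroup_valM.
have hc : continuous h.
  apply/continuousP => A /fo[B oB <-]; exists B => //.
  by apply/seteqP; split => y; rewrite /preimage/= hK.
apply/seteqP; split=> [_ [x rx <-]|_ [y ry <-]].
  by exists (g x) => //; exact: residual_hom.
by exists (h y); [exact: residual_hom|rewrite hK].
Qed.

(** The pullbacks of the [R n H] to [L] form an increasing open cover, and each of them is compactly
    generated with a compact open subgroup. *)
Lemma elementary_decomposition_step (H : closed_subgroup G) : tdlcsc G ->
  (forall n (L : topologicalGroupType) (f : L -> G), {morph f : x y / x * y} ->
    embedding f -> range f = Res (R n H) -> elementary L) ->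
  forall (L : topologicalGroupType) (f : L -> G), {morph f : x y / x * y} ->
    embedding f -> range f = H -> elementary L.
Proof.
move=> tG IH L f fM ef fH.
have fc := embedding_continuous ef.
have [fI fo] := ef.
pose O n : subgroup L := Subgroup (preimage_is_subgroup fM (subgroupP (R n H))).
have oO n : open (O n).
  apply: (open_subgroupS (A := f @^-1` U)); first exact: subgroupP.
  - apply: open_comp => [x _|]; first exact: fc.
    exact: compact_open_subgroup_open.
  - by rewrite /preimage/= hom1//; case: (subgroupP U).
  - move=> x Ux; apply: subset_R_trace; split=> //.
    by rewrite -fH; exists x.
have tL : tdlcsc L.
  by apply: (embedding_closed_tdlcsc ef) => //; rewrite fH; exact: closed_subgroup_closed.
apply: (elementary_union (O := O) tL oO).
- by move=> n x; exact: R_increasing.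
- apply/seteqP; split=> // x _.
  have : range f (f x) by exists x.
  by rewrite fH => /bigcup_R[n _ Rfx]; exists n.
move=> n.
pose g : subgroup_type (O n) -> G := f \o val.
have gM : {morph g : x y / x * y} by move=> x y; rewrite /g /= -fM.
have eg : embedding g by apply: embedding_comp => //; exact: subgroup_embedding.
have gR : range g = R n H.
  apply/seteqP; split=> [_ [x _ <-]|y Ry]; first exact: (subgroup_mem x).
  have : range f y by rewrite fH; exact: subset_R Ry.
  case=> x _ xy; have Ox : (O n : set L) x by rewrite /= /preimage/= xy.
  by exists (exist _ x (mem_set Ox)).
have gc := embedding_continuous eg.
have sV := preimage_is_subgroup gM (subgroupP U).
have cV : compact (g @^-1` U).
  rewrite (_ : _ @^-1` _ = g @^-1` ((U : set G) `&` R n H)).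
    apply: embedding_compact => //; last by rewrite gR => x [].
    apply: compact_closedI; first exact: compact_open_subgroup_compact.
    exact: R_closed.
  by apply/seteqP; split=> x; [move=> Ux; split=> //; rewrite -gR; exists x|case].
have oV : open (g @^-1` U).
  by apply: open_comp => [x _|]; [exact: gc|exact: compact_open_subgroup_open].
pose V := @CompactOpenSubgroup _ (Subgroup sV) cV oV.
apply: (@elementary_compactly_generated _ V (g @^-1` R_generators n H)).
- apply: (embedding_closed_tdlcsc eg) => //.
  by rewrite gR; exact: R_closed.
- apply: embedding_compact => //; first exact: R_generators_compact.
  by rewrite gR; exact: subset_generated.
(* The image of [A] under [g] is a subgroup of [G] containing the generators, hence all of [R n H];
   injectivity of [g] brings this back to [A]. *)
- move=> A sA CA; apply/seteqP; split=> // x _.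
  have : (g @` A) (g x).
    have : (R n H : set G) (g x) by rewrite -gR; exists x.
    apply: generated_min; first exact: image_is_subgroup.
    move=> y Cy; have : range g y by rewrite gR; exact: subset_generated Cy.
    by case=> z _ zy; exists z => //; apply: CA; rewrite /preimage/= zy.
  by case=> y Ay /(proj1 eg) <-.
- move=> K h hM eh hR; apply: (IH n K (g \o h)).
  + by move=> x y /=; rewrite hM gM.
  + exact: embedding_comp.
  + rewrite -(Res_iso gM eg gR) -hR; apply/seteqP; split.
      by move=> _ [x _ <-]; exists (h x).
    by move=> _ [_ [x _ <-] <-]; exists x.
Qed.

Lemma decomposition_tree_elementary : tdlcsc G ->
  well_founded_tree (decomposition_tree U D) -> elementary G.
Proof.
move=> tG wf; apply: contrapT => nG.
(* A bad node is one whose subgroup has a non-elementary copy; the root is bad and every bad node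
   has a bad child. *)
pose bad s := decomposition_tree U D s /\ ~ forall (L : topologicalGroupType)
  (f : L -> G), {morph f : x y / x * y} -> embedding f ->
  range f = decomposition_subgroup U D s -> elementary L.
have bad0 : bad [::].
  split; first exact: decomposition_tree_nil.
  move=> /(_ G id) eG; apply: nG; apply: eG => //.
  - by split=> // A; split=> [oA|[B oB <-]//]; exists A.
  - by rewrite image_id.
have next s : bad s -> exists n, bad (rcons s n).
  move=> [Ts nE]; apply: contrapT => nb; apply: nE.
  (* A leaf is not bad: all copies of the trivial group are discrete and countable. *)
  have [s1|sn1] := pselect (decomposition_subgroup U D s = [set 1] :> set G).
    move=> L f fM [fI fo]; rewrite s1 => f1.
    have L1 (x : L) : x = 1.
      apply: fI; rewrite hom1//.
      by have : range f (f x) by [exists x]; rewrite f1.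
    have LT : [set: L] = [set 1] by apply/seteqP; split=> x // _; exact: L1.
    apply: elementary_discrete; last by rewrite LT; exact: countable1.
    move=> A; have [Ae|/nonemptyPn->] := pselect (A !=set0); last exact: open0.
    rewrite (_ : A = setT); first exact: openT.
    by apply/seteqP; split=> // x _; case: Ae => y Ay; rewrite (L1 x) -(L1 y).
  apply: elementary_decomposition_step => // n L f fM ef fR.
  apply: contrapT => nL; apply: nb; exists n; split.
    exact: decomposition_tree_rcons.
  move=> eL; apply: nL; apply: (eL L f) => //.
  by rewrite /decomposition_subgroup foldl_rcons.
(* Dependent choice: [t n] below is a bad node of length [n], and [nx (t n)] is the next entry of
   the branch. *)
pose nx (t : {s | bad s}) : {n | bad (rcons (sval t) n)} := cid (next _ (svalP t)).
pose t := fix t n : {s | bad s} := if n is m.+1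
  then exist bad _ (svalP (nx (t m))) else exist bad [::] bad0.
apply: wf; exists (fun n => sval (nx (t n))) => n.
rewrite (_ : mkseq _ n = sval (t n)); first by have [] := svalP (t n).
by elim: n => [//|n IHn]; rewrite mkseqS IHn.
Qed.

End decomposition.

(** * From elementarity to well-foundedness *)

Section converse.
Context {G : topologicalGroupType}.
Variables (U : compact_open_subgroup G) (D : selector_functions G).

Local Notation R := (R_ U D).
Local Notation step := (decomposition_step U D).

Definition inclusion (A B : subgroup G) (AB : A `<=` B) (x : subgroup_type A) :
  subgroup_type B := exist _ (val x) (mem_set (AB _ (subgroup_mem x))).

Lemma inclusion_continuous (A B : subgroup G) (AB : A `<=` B) :
  continuous (inclusion AB).
Proof. by apply: continuous_to_subgroup; exact: subgroup_val_continuous. Qed.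

Lemma inclusionM (A B : subgroup G) (AB : A `<=` B) :
  {morph inclusion AB : x y / x * y}.
Proof. by move=> x y; apply: val_inj. Qed.

Lemma inclusion_inj (A B : subgroup G) (AB : A `<=` B) :
  injective (inclusion AB).
Proof. by move=> x y /(congr1 val) /= xy; apply: val_inj. Qed.

Lemma corestriction (L E : topologicalGroupType) (P : subgroup E) (f : L -> E) :
  continuous f -> {morph f : x y / x * y} -> injective f ->
  (forall x, (P : set E) (f x)) ->
  exists g : L -> subgroup_type P,
    [/\ continuous g, {morph g : x y / x * y} & injective g].
Proof.
move=> fc fM fI fP; exists (fun x => exist _ (f x) (mem_set (fP x))); split.
- by apply: continuous_to_subgroup.
- by move=> x y; apply: val_inj; rewrite /= fM.
- by move=> x y /(congr1 val) /=; exact: fI.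
Qed.

Lemma step_subset n (H : closed_subgroup G) : step H n `<=` H.
Proof. by move=> _ [x _ <-]; exact: subset_R (subgroup_mem x). Qed.

(** Passes from the residual computed inside [R n H] to the subgroup of [G] that it defines. *)
Lemma step_image n (H : closed_subgroup G) (E : topologicalGroupType)
    (f : subgroup_type H -> E) (P : set E) :
  residual (subgroup_type (R n H)) `<=`
    (f \o inclusion (@subset_R _ U D n H)) @^-1` P ->
  forall x, P (f (inclusion (@step_subset n H) x)).
Proof.
move=> rP x; have [r rr rx] := subgroup_mem x.
rewrite (_ : inclusion _ x = inclusion (@subset_R _ U D n H) r); first exact: rP.
by apply: val_inj; rewrite /= -rx.
Qed.

(** Around a point of [W m], the set [W m] itself is a neighbourhood contained in [W n] for all n >=
    m, so near-covering compactness applies along [\oo]. *)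
Lemma compact_increasing_cover (X : topologicalType) (K : set X)
    (W : nat -> set X) :
  compact K -> (forall n, open (W n)) -> (forall n, W n `<=` W n.+1) ->
  K `<=` \bigcup_n W n -> exists n, K `<=` W n.
Proof.
move=> /compact_near_coveringP cK oW WS KW.
have Wmono m n : (m <= n)%N -> W m `<=` W n.
  move=> /subnK <-; elim: (n - m)%N => // k IHk x /IHk.
  by rewrite addSn; exact: WS.
suff : \forall n \near \oo, K `<=` W n by case/filter_ex => n; exists n.
apply: cK => x /KW[m _ Wx].
exists (W m, [set n | (m <= n)%N]) => /=.
  by split; [exact: open_nbhs_nbhs|exact: nbhs_infty_ge].
by move=> [y n] /= [Wy mn]; exact: Wmono Wy.
Qed.

(** The root [H] is arbitrary so that induction on [E] can pass to the next subgroup of the branch;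
    restriction and corestriction keep [f] a continuous injective homomorphism. *)
Lemma elementary_no_infinite_branch (E : topologicalGroupType) : elementary E ->
  forall (H : closed_subgroup G) (f : subgroup_type H -> E),
    continuous f -> {morph f : x y / x * y} -> injective f ->
  forall a : nat -> nat,
    ~ forall n, foldl step H (mkseq a n) <> [set 1] :> set G.
Proof.
(* Once the residual of [R (a 0) H] maps into [P], the next subgroup injects into [P], and the
   induction hypothesis for [P] excludes the shifted branch. *)
have descend (F : topologicalGroupType) (H : closed_subgroup G)
    (f : subgroup_type H -> F) (P : subgroup F) (a : nat -> nat) :
    (forall (K : closed_subgroup G) (g : subgroup_type K -> subgroup_type P),
      continuous g -> {morph g : x y / x * y} -> injective g ->
      forall b : nat -> nat,
        ~ forall n, foldl step K (mkseq b n) <> [set 1] :> set G) ->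
    continuous f -> {morph f : x y / x * y} -> injective f ->
    residual (subgroup_type (R (a 0) H)) `<=`
      (f \o inclusion (@subset_R _ U D (a 0) H)) @^-1` P ->
    ~ forall n, foldl step H (mkseq a n) <> [set 1] :> set G.
  move=> IH fc fM fI /step_image fP nt.
  pose h := f \o inclusion (@step_subset (a 0) H).
  have [||| |g [gc gM gI]] := @corestriction _ _ P h.
  - by move=> x; apply: continuous_comp; [exact: inclusion_continuous|exact: fc].
  - by move=> x y; rewrite /h /= inclusionM fM.
  - by apply: inj_comp => //; exact: inclusion_inj.
  - exact: fP.
  apply: (IH _ g gc gM gI (a \o succn)) => n.
  have := nt n.+1.
  by rewrite /mkseq /= -[1%N]addn0 iotaDl -map_comp.
(* If [F] has trivial residual, the branch already reaches the trivial subgroup at length 1. *)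
have trivial (F : topologicalGroupType) (H : closed_subgroup G)
    (f : subgroup_type H -> F) (a : nat -> nat) :
    residual F `<=` [set 1] ->
    continuous f -> {morph f : x y / x * y} -> injective f ->
    ~ forall n, foldl step H (mkseq a n) <> [set 1] :> set G.
  move=> rF fc fM fI /(_ 1%N); apply; rewrite /=.
  have fP : forall x, [set 1] (f (inclusion (@step_subset (a 0) H) x)).
    apply: step_image => x rx; apply: rF; apply: residual_hom rx.
    - by move=> y; apply: continuous_comp; [exact: inclusion_continuous|exact: fc].
    - by move=> y z; rewrite /= inclusionM fM.
  apply/seteqP; split=> [x Kx|_ ->]; last by case: (subgroupP (step H (a 0))).
  have := fP (exist _ x (mem_set Kx)); rewrite -(hom1 fM) => /fI.
  by move=> /(congr1 val).
elim=> {E}.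
- by move=> E pE _ H f fc fM fI a; apply: trivial (profinite_residual pE) fc fM fI.
- by move=> E dE _ H f fc fM fI a; apply: trivial (discrete_residual dE) fc fM fI.
- move=> E N _ _ _ IH pd H f fc fM fI a.
  apply: (descend _ _ _ _ _ IH fc fM fI).
  apply: residual_sub_kernel pd.
  + by move=> x; apply: continuous_comp; [exact: inclusion_continuous|exact: fc].
  + by move=> x y; rewrite /= inclusionM fM.
move=> E O _ oO OS OT _ IH H f fc fM fI a.
have ev := subgroup_embedding H.
(* The compact set of generators of [R (a 0) H] maps into a single [O i]; hence so does the whole
   group, not only its residual. *)
have [i Ci] : exists i,
    val @^-1` R_generators U D (a 0) H `<=` f @^-1` O i.
  apply: compact_increasing_cover.
  - apply: embedding_compact => //; first exact: R_generators_compact.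
    rewrite range_subgroup_val => x Cx.
    by apply: (@subset_R _ U D (a 0)); exact: subset_generated.
  - by move=> n; apply: open_comp => // x _; exact: fc.
  - by move=> n x; exact: OS.
  - move=> x _; have : (\bigcup_i O i) (f x) by rewrite OT.
    by case=> i _ Ox; exists i.
apply: (descend _ _ _ _ _ (IH i) fc fM fI) => x _.
have sB := image_is_subgroup (subgroup_valM (A := H))
  (preimage_is_subgroup fM (subgroupP (O i))).
have : R (a 0) H `<=` val @` (f @^-1` O i).
  apply: generated_min => // y Cy.
  have Hy : (H : set G) y.
    by apply: (@subset_R _ U D (a 0)); exact: subset_generated.
  by exists (exist _ y (mem_set Hy)) => //; exact: Ci.
move=> /(_ _ (subgroup_mem x))[y Oy yx].
rewrite /preimage /= (_ : inclusion _ x = y) //.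
by apply: val_inj; rewrite /= -yx.
Qed.

End converse.

Theorem theorem4p7 (G : topologicalGroupType) (tdG : tdlcsc G)
    (U : compact_open_subgroup G) (D : selector_functions G) :
  elementary G <-> well_founded_tree (decomposition_tree U D).
Proof.
split=> [eG [a Ta]|]; last exact: decomposition_tree_elementary.
apply: (elementary_no_infinite_branch (U := U) (D := D) eG
  (H := full_subgroup) (f := val) _ _ _ (a := a)).
- exact: subgroup_val_continuous.
- exact: subgroup_valM.
- exact: val_inj.
(* Membership of the node of length [n.+1] is what certifies that the subgroup at its prefix of
   length [n] is nontrivial. *)
move=> n; have : decomposition_tree U D (mkseq a n.+1) by exact: Ta.
rewrite mkseqS; move Es : (rcons _ _) => s Ts.
case: Ts Es => [|t m _ nt /rcons_inj[-> _]]; last exact: nt.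
by case: (mkseq _ _).
Qed.
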